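(* Let $p$ be a prime and $h\ge 2$. Let $g\in\mathbb{S}_h$, with associated ring homomorphism $g_*:R\to R$ and unit $t_0=t_0(g)\in R$. Then $$g_*(u_{h-1}) = u_{h-1}\, t_0^{p^{h-1}-1} \mod I_{h-1}.$$
   Context: Let $\mathbb{W}=W(\mathbb{F}_{p^h})$ be the Witt vectors, $R=\mathbb{W}[[u_1,\dots,u_{h-1}]]$ with maximal ideal $(p,u_1,\dots,u_{h-1})$, and $I_{h-1}=(p,u_1,\dots,u_{h-2})$ (so $I_1=(p)$ when $h=2$). Let $\mathbb{H}$ be the Honda formal group law of height $h$: the unique $p$-typical formal group law over $\mathbb{F}_p$ with $p$-series $[p]_{\mathbb{H}}(x)=x^{p^h}$, regarded over $\mathbb{F}_{p^h}$. Universal deformation: let $V=\mathbb{Z}_{(p)}[v_1,v_2,\dots]$ be the ring representing $p$-typical formal group laws over $\mathbb{Z}_{(p)}$-algebras, with universal $p$-typical formal group law $G$ of logarithm $\sum_{i\ge0}l_ix^{p^i}$, $l_0=1$, where the $v_i$ are the Araki generators: $v_0=p$ and $p\,l_n=\sum_{0\le i\le n}l_iv_{n-i}^{p^i}$. Let $\phi:V\to R$ send $v_i\mapsto u_i$ for $1\le i\le h-1$, $v_h\mapsto1$, $v_i\mapsto0$ for $i>h$, and set $F=\phi_*G$. $F$ is a universal deformation of $\mathbb{H}$: a deformation of $\mathbb{H}$ to a complete local ring $A$ with maximal ideal $\mathfrak m$ is a formal group law over $A$ together with an inclusion $i:\mathbb{F}_{p^h}\to A/\mathfrak m$ such that the reduction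 of the formal group law mod $\mathfrak m$ is $i_*\mathbb{H}$; a $\star$-isomorphism is an isomorphism of formal group laws $f$ with $f(x)\equiv x$ mod $\mathfrak m$; and for each deformation $(H,i)$ to $A$ there are a unique continuous $\mathbb{W}$-algebra map $\iota:R\to A$ and a unique $\star$-isomorphism $\iota_*F\to H$. $\mathbb{S}_h$ is the automorphism group of $\mathbb{H}$ over $\mathbb{F}_{p^h}$, identified with the unit group of $\mathbb{W}\langle S\rangle/(S^h=p,\ Sa=a^\sigma S)$ ($a\in\mathbb{W}$, $\sigma$ the lift of Frobenius); its elements are written $g=\sum_{i\ge0}g_iS^i$ with $g_i\in\mathbb{W}$, $g_i^{p^h}=g_i$. Action: lift $g\in\mathbb{S}_h$ to $\hat g(x)\in\mathbb{W}[[x]]$ and set $\hat F(x,y)=\hat g^{-1}(F(\hat g(x),\hat g(y)))$. Then $(\hat F,\mathrm{id})$ is a deformation of $\mathbb{H}$ to $R$, so it determines a unique homomorphism $g_*:R\to R$ and a unique $\star$-isomorphism $g_*F\to\hat F$. The composite $h_g:g_*F\to\hat F\xrightarrow{\hat g}F$ is independent of the choice of $\hat g$ and can be written uniquely as a formal sum $h_g(x)=\sum^F_{i\ge0}t_i(g)x^{p^i}$ with $t_i=t_i(g)\in R$; $t_i\equiv g_i$ modulo $(p,u_1,\dots,u_{h-1})$ and $t_0$ is a unit. *)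

(* Defs.v *)
From HB Require Import structures.
From mathcomp Require Import all_boot all_order all_algebra.
From mathcomp Require Import boolp finmap monalg mpoly.

Set Implicit Arguments.
Unset Strict Implicit.
Unset Printing Implicit Defensive.

Import Order.TTheory GRing.Theory Num.Theory.
Local Open Scope ring_scope.


(* -------------------------------------------------------------------- *)
(** Formal power series in [n] commuting variables: a series is the
    function sending a monomial to its coefficient.  The type ['X_{1..n}]
    is the one of [mpoly]. *)

Definition mps (n : nat) (A : comNzRingType) : Type := 'X_{1..n} -> A.

HB.instance Definition _ n A :=
  Choice.copy (mps n A) (forall _ : 'X_{1..n}, A).

Section PowerSeriesRing.
Context (n : nat) (A : comNzRingType).
Implicit Types (f g : mps n A) (m : 'X_{1..n}).

Definition mps_zero : mps n A := fun=> 0.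
Definition mps_opp f : mps n A := fun m => - f m.
Definition mps_add f g : mps n A := fun m => f m + g m.

Definition mpsC (c : A) : mps n A := fun m => c *+ (m == 0%MM).
Definition mpsX (i : 'I_n) : mps n A := fun m => (m == U_(i)%MM)%:R.

Definition mps_mul f g : mps n A := fun m =>
  \sum_(k : 'X_{1..n < (mdeg m).+1, (mdeg m).+1} | m == (k.1 + k.2)%MM)
    f k.1 * g k.2.

Fact mps_addA : associative mps_add.
Proof. by move=> f g e; apply/funext => m; rewrite /mps_add addrA. Qed.
Fact mps_addC : commutative mps_add.
Proof. by move=> f g; apply/funext => m; rewrite /mps_add addrC. Qed.
Fact mps_add0 : left_id mps_zero mps_add.
Proof. by move=> f; apply/funext => m; rewrite /mps_add add0r. Qed.
Fact mps_addN : left_inverse mps_zero mps_opp mps_add.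
Proof. by move=> f; apply/funext => m; rewrite /mps_add addNr. Qed.

HB.instance Definition _ :=
  GRing.isZmodule.Build (mps n A) mps_addA mps_addC mps_add0 mps_addN.

(* Truncation to a polynomial: the ring axioms are inherited from
   [mpoly n A], coefficient by coefficient. *)
Definition mps_trunc (d : nat) f : mpoly n A :=
  \sum_(m : 'X_{1..n < d}) f m *: 'X_[m].

Lemma mps_truncE d f m : (mdeg m < d)%N -> (mps_trunc d f)@_m = f m.
Proof. exact: mcoeff_mpoly. Qed.

Lemma mcoeffM_eq (P Q P' Q' : mpoly n A) m :
  (forall k, (mdeg k <= mdeg m)%N -> P@_k = P'@_k) ->
  (forall k, (mdeg k <= mdeg m)%N -> Q@_k = Q'@_k) ->
  (P * Q)@_m = (P' * Q')@_m.
Proof.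
move=> eP eQ; rewrite !mcoeffM; apply: eq_bigr => -[k1 k2] /= _.
by rewrite eP ?eQ // -ltnS bmdeg.
Qed.

Lemma mps_mul_trunc d f g m : (mdeg m < d)%N ->
  mps_mul f g m = (mps_trunc d f * mps_trunc d g)@_m.
Proof.
move=> lt_md; rewrite mcoeffM; apply: eq_bigr => -[k1 k2] /= _.
by rewrite !mps_truncE // (leq_trans _ lt_md) // bmdeg.
Qed.

Fact mps_mulA : associative mps_mul.
Proof.
move=> f g e; apply/funext => m; set d := (mdeg m).+1.
rewrite !(@mps_mul_trunc d) //.
transitivity (mps_trunc d f * (mps_trunc d g * mps_trunc d e))@_m.
  apply: mcoeffM_eq => // k le_km.
  by rewrite mps_truncE // (@mps_mul_trunc d).
rewrite mulrA; apply: mcoeffM_eq => // k le_km.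
by rewrite mps_truncE // (@mps_mul_trunc d).
Qed.

Fact mps_mulC : commutative mps_mul.
Proof.
move=> f g; apply/funext => m.
by rewrite !(@mps_mul_trunc (mdeg m).+1) // mulrC.
Qed.

Fact mps_mul1 : left_id (mpsC 1) mps_mul.
Proof.
move=> f; apply/funext => m; set d := (mdeg m).+1.
rewrite (@mps_mul_trunc d) // -(@mps_truncE d f) // -[in RHS](mul1r (mps_trunc d f)).
apply: mcoeffM_eq => // k le_km.
by rewrite mps_truncE // mcoeff1.
Qed.

Fact mps_mulDl : left_distributive mps_mul mps_add.
Proof.
move=> f g e; apply/funext => m; rewrite /mps_add /mps_mul -big_split /=.
by apply: eq_bigr => k _; rewrite mulrDl.
Qed.

Fact mps_1neq0 : mpsC 1 != 0.
Proof.
by apply/eqP => /(congr1 (fun f : mps n A => f 0%MM)) /eqP; rewrite /mpsC eqxx oner_eq0.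
Qed.

HB.instance Definition _ := GRing.Zmodule_isComNzRing.Build (mps n A)
  mps_mulA mps_mulC mps_mul1 mps_mulDl mps_1neq0.

End PowerSeriesRing.

Arguments mpsC n {A} c m : rename.
Arguments mpsX {n} A i m : rename.

Definition map_mps (A B : comNzRingType) n (j : A -> B) (f : mps n A) :
  mps n B := fun m => j (f m).

(** [mcomp f G] is [f(G_1, ..., G_n)].  The truncation at the degree of the
    monomial is the correct value when all the [G_i] have zero constant term,
    which is the case at every use below. *)
Definition mcomp (A : comNzRingType) n r (f : mps n A)
    (G : n.-tuple (mps r A)) : mps r A := fun m =>
  \sum_(k : 'X_{1..n < (mdeg m).+1})
    f k * (\prod_(i < n) tnth G i ^+ (k : 'X_{1..n}) i : mps r A) m.

(* -------------------------------------------------------------------- *)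
Definition ideal_span (A : comNzRingType) (s : seq A) (x : A) : Prop :=
  exists a : 'I_(size s) -> A, x = \sum_i a i * s`_i.

Definition ideal_pow (A : comNzRingType) (I : A -> Prop) (n : nat) (x : A) :=
  exists r (a : 'I_r -> A) (b : 'I_r -> 'I_n -> A),
    (forall i j, I (b i j)) /\ x = \sum_i a i * \prod_j b i j.

(** Continuity of an additive map for the [I]-adic topology. *)
Definition adic_continuous (A : comNzRingType) (I : A -> Prop) (j : A -> A) :=
  forall n, exists r, forall x, ideal_pow I r x -> ideal_pow I n (j x).

(* -------------------------------------------------------------------- *)
Section FormalGroupLaws.
Context (A : comNzRingType).
Implicit Types (F : mps 2 A) (f : mps 1 A).

Let x1 : mps 1 A := mpsX A ord0.

Definition is_fgl F :=
  [/\ mcomp F [tuple x1; 0] = x1,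
      mcomp F [tuple 0; x1] = x1,
      mcomp F [tuple mpsX A 1; mpsX A 0] = F &
      let x : mps 3 A := mpsX A 0 in
      let y : mps 3 A := mpsX A 1 in
      let z : mps 3 A := mpsX A 2 in
      mcomp F [tuple mcomp F [tuple x; y]; z]
        = mcomp F [tuple x; mcomp F [tuple y; z]]].

Definition fadd n F (f g : mps n A) : mps n A := mcomp F [tuple f; g].

(** The formal sum of [a 0], ..., [a (r - 1)], the [r]-series, and the
    assertion that [s] is the (coefficientwise stationary) limit of the
    finite formal sums of the [a i]. *)
Definition fsum n F (a : nat -> mps n A) (r : nat) : mps n A :=
  foldr (fadd F) 0 (mkseq a r).

Definition nseries F (r : nat) : mps 1 A := fsum F (fun=> x1) r.

Definition is_infinite_fsum n F (a : nat -> mps n A) (s : mps n A) :=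
  forall m, exists N, forall r, (N <= r)%N -> fsum F a r m = s m.

Definition comp_inverse (f f' : mps 1 A) :=
  [/\ f 0%MM = 0, f' 0%MM = 0,
      mcomp f [tuple f'] = x1 & mcomp f' [tuple f] = x1].

Definition fgl_hom F1 F2 f := f 0%MM = 0 /\
  mcomp f [tuple F1]
    = fadd F2 (mcomp f [tuple mpsX A (0 : 'I_2)])
              (mcomp f [tuple mpsX A (1 : 'I_2)]).

Definition fgl_iso F1 F2 f :=
  fgl_hom F1 F2 f /\ exists f', comp_inverse f f'.

Definition star_iso (I : A -> Prop) F1 F2 f :=
  fgl_iso F1 F2 f /\ forall m, I (f m - x1 m).

End FormalGroupLaws.

(** [p]-typicality of a formal group law over a [Z_(p)]-algebra (the vanishing
    of the Frobenius operators on the curve [x]): for each prime [q != p] the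
    formal sum of the [z^i x], [0 <= i < q], vanishes, where [z] is a root of
    the [q]-th cyclotomic polynomial in an extension of scalars. *)
Definition p_typical (p : nat) (A : comNzRingType) (F : mps 2 A) :=
  forall q, prime q -> q != p ->
  forall (B : comNzRingType) (j : {rmorphism A -> B}) (z : B),
    \sum_(i < q) z ^+ i = 0 ->
    fsum (map_mps j F) (fun i => mpsC 1 (z ^+ i) * mpsX B ord0) q = 0.

(* -------------------------------------------------------------------- *)
Definition ghost (A : comNzRingType) (p n : nat) (a : nat -> A) : A :=
  \sum_(i < n.+1) (p ^ i)%:R * a i ^+ (p ^ (n - i)).

(** The polynomial ring [Z[X_0, X_1, ..., Y_0, Y_1, ...]]. *)
Definition witt_poly : Type := {malg int[{cmonom (bool * nat)%type}]}.
HB.instance Definition _ := GRing.ComNzRing.on witt_poly.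

Definition wittX (i : nat) : witt_poly := << ucm (false, i) >>.
Definition wittY (i : nat) : witt_poly := << ucm (true, i) >>.

Definition witt_eval (A : comNzRingType) (a b : nat -> A) (P : witt_poly) : A :=
  monalg.mmap (fun z : int => z%:~R)
    (fun m : {cmonom (bool * nat)%type} =>
       \prod_(i <- finsupp m) (if i.1 then b i.2 else a i.2) ^+ m i) P.

(** [c w i] is the [i]-th Witt coordinate of [w]. *)
Definition is_witt (p : nat) (k W : comNzRingType) (c : W -> nat -> k) :=
  [/\ injective c,
      forall s : nat -> k, exists w, c w = s,
      exists S : nat -> witt_poly,
        (forall n, ghost p n S = ghost p n wittX + ghost p n wittY) /\
        (forall w w' n, c (w + w') n = witt_eval (c w) (c w') (S n)) &
      exists M : nat -> witt_poly,
        (forall n, ghost p n M = ghost p n wittX * ghost p n wittY) /\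
        (forall w w' n, c (w * w') n = witt_eval (c w) (c w') (M n))].

(* -------------------------------------------------------------------- *)
Definition is_honda (p h : nat) (k : comNzRingType) (H : mps 2 k) :=
  exists (H0 : mps 2 'F_p) (j : {rmorphism 'F_p -> k}),
    [/\ is_fgl H0, p_typical p H0,
        nseries H0 p = mpsX 'F_p ord0 ^+ (p ^ h) & H = map_mps j H0].

(* -------------------------------------------------------------------- *)
Definition zlocal (p : nat) : {pred rat} :=
  fun x => coprime p `|denq x|%N.

Fact zlocal_subring p : subring_closed (zlocal p).
Proof.
have dvd_co (x : rat) (a d : int) : coprime p `|d| -> d != 0 ->
    x = a%:~R / d%:~R -> x \in zlocal p.
  move=> co_pd d0 ->; apply: coprime_dvdr co_pd.
  move: d0; case: divqP => [|m y _ _]; first by rewrite eqxx.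
  by rewrite abszM dvdn_mull.
have den0 (x : rat) : (denq x)%:~R != 0 :> rat by rewrite intr_eq0 denq_neq0.
split.
- by rewrite unfold_in /zlocal /= coprimen1.
- move=> x y px py.
  apply: (dvd_co _ (numq x * denq y - numq y * denq x) (denq x * denq y)).
  + by rewrite abszM coprimeMr; apply/andP.
  + by rewrite mulf_neq0 ?denq_neq0.
  + rewrite -[in LHS](divq_num_den x) -[in LHS](divq_num_den y).
    by rewrite -mulNr addf_div // rmorphB !rmorphM /= mulNr.
- move=> x y px py.
  apply: (dvd_co _ (numq x * numq y) (denq x * denq y)).
  + by rewrite abszM coprimeMr; apply/andP.
  + by rewrite mulf_neq0 ?denq_neq0.
  + rewrite -[in LHS](divq_num_den x) -[in LHS](divq_num_den y).
    by rewrite mulf_div !rmorphM.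
Qed.

HB.instance Definition _ p :=
  GRing.isSubringClosed.Build rat (zlocal p) (zlocal_subring p).

Record Zloc (p : nat) := MkZloc { zloc_val :> rat; _ : zloc_val \in zlocal p }.
HB.instance Definition _ p := [isSub for @zloc_val p].
HB.instance Definition _ p := [Choice of Zloc p by <:].
HB.instance Definition _ p := [SubChoice_isSubComNzRing of Zloc p by <:].

(** The monomial [ucm i] stands for the generator [v_(i+1)]; [v_0 = p]. *)
Definition VZ (p : nat) : Type := {malg (Zloc p)[{cmonom nat}]}.
HB.instance Definition _ p := GRing.ComNzRing.on (VZ p).
Definition VQ : Type := {malg rat[{cmonom nat}]}.
HB.instance Definition _ := GRing.ComNzRing.on VQ.

Definition vZ (p i : nat) : VZ p :=
  if i is j.+1 then << ucm j >> else p%:R.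
Definition vQ (p i : nat) : VQ :=
  if i is j.+1 then << ucm j >> else p%:R.

Definition VZ_to_VQ (p : nat) (P : VZ p) : VQ :=
  \sum_(m <- monalg.msupp P) << zloc_val (monalg.mcoeff m P) *g m >>.

(** The coefficients [l_i] of the logarithm, for the Araki generators. *)
Definition is_araki (p : nat) (l : nat -> VQ) := l 0%N = 1 /\
  forall n, p%:R * l n = \sum_(i < n.+1) l i * vQ p (n - i) ^+ (p ^ i).

(** The series [sum_i l_i x^(p^i)]. *)
Definition plog (p : nat) (A : comNzRingType) (l : nat -> A) : mps 1 A :=
  fun m => \sum_(i < (mdeg m).+1 | mdeg m == (p ^ i)%N) l i.

Definition is_universal_ptypical (p : nat) (G : mps 2 (VZ p)) :=
  is_fgl G /\
  exists l : nat -> VQ, is_araki p l /\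
    mcomp (plog p l) [tuple map_mps (@VZ_to_VQ p) G]
      = mcomp (plog p l) [tuple mpsX VQ (0 : 'I_2)]
        + mcomp (plog p l) [tuple mpsX VQ (1 : 'I_2)].

(* -------------------------------------------------------------------- *)
(** [W[[u_1, ..., u_(h-1)]]], the base ring of the universal deformation. *)
Definition LT (h : nat) (W : comNzRingType) : Type := mps h.-1 W.
HB.instance Definition _ h W := GRing.ComNzRing.on (LT h W).

(** [u_i], for [1 <= i <= h - 1]; the value at the other [i] is irrelevant. *)
Definition LTu (h : nat) (W : comNzRingType) (i : nat) : LT h W :=
  if insub i.-1 is Some j then mpsX W j else 0.
Arguments LTu : clear implicits.

(** The ideal [I_n = (p, u_1, ..., u_(n-1))], so that [I_h] is the maximal
    ideal of [R]. *)
Definition LTI (p h : nat) (W : comNzRingType) (n : nat) : LT h W -> Prop :=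
  ideal_span (p%:R :: [seq LTu h W i | i <- iota 1 n.-1]).
Arguments LTI : clear implicits.

(** [F = phi_* G]; [phi] is determined by its values on the [v_i], since [R]
    has at most one structure of [Z_(p)]-algebra. *)
Definition is_lubin_tate_fgl (p h : nat) (W : comNzRingType)
    (F : mps 2 (LT h W)) :=
  exists (G : mps 2 (VZ p)) (phi : {rmorphism VZ p -> LT h W}),
    [/\ is_universal_ptypical G,
        forall i, (0 < i < h)%N -> phi (vZ p i) = LTu h W i,
        phi (vZ p h) = 1,
        forall i, (h < i)%N -> phi (vZ p i) = 0 &
        F = map_mps phi G].

(* -------------------------------------------------------------------- *)
Section Action.
Context (p h : nat) (k W : comNzRingType) (c : W -> nat -> k).
Let R := LT h W.
Implicit Types (F : mps 2 R).

Definition stabilizer (H : mps 2 k) (g : mps 1 k) := fgl_iso H H g.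

(** [ghat] lifts [g], and [ghat'] is its inverse for the composition. *)
Definition is_lift (g : mps 1 k) (ghat ghat' : mps 1 W) :=
  comp_inverse ghat ghat' /\ map_mps (fun w => c w 0%N) ghat = g.

Definition twist F (ghat ghat' : mps 1 R) : mps 2 R :=
  mcomp ghat' [tuple fadd F (mcomp ghat [tuple mpsX R (0 : 'I_2)])
                            (mcomp ghat [tuple mpsX R (1 : 'I_2)])].

(** [gstar] and [t] are the endomorphism of [R] and the coefficients attached
    to [g]: [f] is the star-isomorphism from [gstar_* F] to the twist of [F]
    by a lift of [g], and [h_g] is the composite of [f] with that lift. *)
Definition is_action F (g : mps 1 k) (gstar : {rmorphism R -> R})
    (t : nat -> R) :=
  exists (ghat ghat' : mps 1 W) (f : mps 1 R),
    let lift := map_mps (@mpsC h.-1 W : W -> R) ghat in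
    let lift' := map_mps (@mpsC h.-1 W : W -> R) ghat' in
    [/\ is_lift g ghat ghat',
        forall w : W, gstar (mpsC h.-1 w) = mpsC h.-1 w,
        adic_continuous (LTI p h W h) gstar,
        star_iso (LTI p h W h) (map_mps gstar F) (twist F lift lift') f &
        is_infinite_fsum F (fun i => mpsC 1 (t i) * mpsX R ord0 ^+ (p ^ i))
          (mcomp lift [tuple f])].

End Action.

(* Main.v *)
(** A homomorphism [f] from [F'] to [F] commutes with the [p]-series, so
    [f([p]_F'(x)) = [p]_F(f(x))].  For [F] the push-forward of the universal
    [p]-typical law, the Araki relations give
    [[p]_F(x) = v_n x^(p^n)] modulo [(v_0, ..., v_(n-1))] and degree [> p^n].
    Apply this to [f = h_g : g_* F -> F], whose linear coefficient is the unit
    [t_0], modulo [I = I_(h-1)], and put [q = p^(h-1)]: cancelling [f] in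
    [f([p]_(g_* F)(x)) = u_(h-1) t_0^q x^q] leaves
    [[p]_(g_* F)(x) = u_(h-1) t_0^(q-1) x^q] modulo [I] and degree [> q].
    On the other side the [p]-series of [g_* F] is the image of that of [F];
    comparing the coefficients of [x^(p^n)] for [n < h-1] shows by induction
    that [g_*] maps [I] into [I], and [n = h-1] is the claim. *)

Require Import Defs.
From HB Require Import structures.
From mathcomp Require Import all_boot all_order all_algebra.
From mathcomp Require Import boolp finmap monalg mpoly.
From mathcomp Require Import ring.

Set Implicit Arguments.
Unset Strict Implicit.
Unset Printing Implicit Defensive.

Import GRing.Theory.
Local Open Scope ring_scope.

(** * Ideals and power series modulo a degree *)

Definition is_ideal (A : comNzRingType) (I : A -> Prop) :=
  [/\ I 0, forall x y, I x -> I y -> I (x + y) & forall a x, I x -> I (a * x)].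

Section Ideals.
Context (A : comNzRingType) (I : A -> Prop) (idI : is_ideal I).

Lemma idl0 : I 0. Proof. by case: idI. Qed.

Lemma idlD x y : I x -> I y -> I (x + y). Proof. by case: idI => _ + _; exact. Qed.

Lemma idlMl a x : I x -> I (a * x). Proof. by case: idI => _ _; exact. Qed.

Lemma idlMr a x : I x -> I (x * a). Proof. by rewrite mulrC; exact: idlMl. Qed.

Lemma idlN x : I x -> I (- x).
Proof. by rewrite -mulN1r; exact: idlMl. Qed.

Lemma idlB x y : I x -> I y -> I (x - y).
Proof. by move=> Ix Iy; apply: idlD => //; exact: idlN. Qed.

Lemma idl_sum (J : Type) (r : seq J) (P : pred J) (E : J -> A) :
  (forall i, P i -> I (E i)) -> I (\sum_(i <- r | P i) E i).
Proof. by move=> IE; apply: big_ind => //; [exact: idl0|exact: idlD]. Qed.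

Lemma idl_sub_trans y x z : I (x - y) -> I (y - z) -> I (x - z).
Proof. by move=> Ixy Iyz; have := idlD Ixy Iyz; rewrite addrA subrK. Qed.

End Ideals.

(** With the zero ideal, exact equality up to a degree becomes a case of congruence modulo an ideal,
    so one calculus serves both. *)
Definition zero_ideal (A : comNzRingType) (x : A) : Prop := x = 0.

Lemma zero_is_ideal (A : comNzRingType) : is_ideal (@zero_ideal A).
Proof.
by split=> [//|x y -> ->|a x ->]; rewrite /zero_ideal ?addr0 ?mulr0.
Qed.

Lemma ideal_span_is_ideal (A : comNzRingType) (s : seq A) :
  is_ideal (ideal_span s).
Proof.
split=> [|x y [a ->] [b ->]|c x [a ->]].
- by exists (fun=> 0); rewrite big1 // => i _; rewrite mul0r.
- exists (fun i => a i + b i); rewrite -big_split /=.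
  by apply: eq_bigr => i _; rewrite mulrDl.
- exists (fun i => c * a i); rewrite mulr_sumr.
  by apply: eq_bigr => i _; rewrite mulrA.
Qed.

Lemma ideal_span_mem (A : comNzRingType) (s : seq A) (x : A) :
  x \in s -> ideal_span s x.
Proof.
move=> xs; have ix : (index x s < size s)%N by rewrite index_mem.
exists (fun i => (i == Ordinal ix)%:R).
rewrite (bigD1 (Ordinal ix)) //= eqxx mul1r nth_index // big1 ?addr0 //.
by move=> i /negbTE ->; rewrite mul0r.
Qed.

Lemma ideal_span_sub (A : comNzRingType) (I : A -> Prop) (s : seq A) (x : A) :
  is_ideal I -> (forall y, y \in s -> I y) -> ideal_span s x -> I x.
Proof.
move=> idI sI [a ->]; apply: idl_sum => // i _.
by apply: idlMl => //; apply: sI; rewrite mem_nth.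
Qed.

Section SeriesCoefficients.
Context (n : nat) (A : comNzRingType).
Implicit Types (f g : mps n A) (m : 'X_{1..n}).

Lemma mpsDE f g m : (f + g) m = f m + g m. Proof. by []. Qed.
Lemma mpsBE f g m : (f - g) m = f m - g m. Proof. by []. Qed.
Lemma mps0E m : (0 : mps n A) m = 0. Proof. by []. Qed.

Lemma mps_sumE (J : Type) (r : seq J) (P : pred J) (E : J -> mps n A) m :
  (\sum_(i <- r | P i) E i) m = \sum_(i <- r | P i) E i m.
Proof. exact: (big_morph (fun f : mps n A => f m)). Qed.

Lemma mpsME f g m : (f * g) m =
  \sum_(k : 'X_{1..n < (mdeg m).+1, (mdeg m).+1} | m == (k.1 + k.2)%MM)
    f k.1 * g k.2.
Proof. by []. Qed.

Lemma mpsM_trunc d f g m : (mdeg m < d)%N ->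
  (f * g) m = (mps_trunc d f * mps_trunc d g)@_m.
Proof. exact: mps_mul_trunc. Qed.

Lemma mpsCM (c : A) f m : (mpsC n c * f) m = c * f m.
Proof.
rewrite (@mpsM_trunc (mdeg m).+1) // -(mps_truncE f (ltnSn (mdeg m))) -mcoeffCM.
apply: mcoeffM_eq => // k le_km.
by rewrite mps_truncE // mcoeffC /mpsC; case: eqP => _; rewrite ?mulr1n ?mulr1 // mulr0.
Qed.

Lemma mpsX_coef (i j : 'I_n) : mpsX A i U_(j)%MM = (i == j)%:R.
Proof. by rewrite /mpsX eq_mnm1 eq_sym. Qed.

Fact mpsC_additive : additive (mpsC n : A -> mps n A).
Proof. by move=> a b; apply/funext => m; rewrite mpsBE /mpsC mulrnBl. Qed.

Fact mpsC_multiplicative : monoid_morphism (mpsC n : A -> mps n A).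
Proof.
by split=> // a b; apply/funext => m; rewrite mpsCM /mpsC mulrnAr.
Qed.

HB.instance Definition _ :=
  GRing.isZmodMorphism.Build A (mps n A) (mpsC n) mpsC_additive.
HB.instance Definition _ :=
  GRing.isMonoidMorphism.Build A (mps n A) (mpsC n) mpsC_multiplicative.

End SeriesCoefficients.

(** Applied to a difference, this is congruence modulo [I] and modulo terms of degree at least [d],
    the form taken by every approximation below. *)
Definition vanishes_below n (A : comNzRingType) (I : A -> Prop) (d : nat)
  (f : mps n A) := forall m, (mdeg m < d)%N -> I (f m).

Section VanishesBelow.
Context (n : nat) (A : comNzRingType) (I : A -> Prop) (idI : is_ideal I).
Implicit Types (f g : mps n A) (d e : nat).

Local Notation van := (vanishes_below I).

Lemma van0 d : van d (0 : mps n A).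
Proof. by move=> m _; exact: idl0. Qed.

Lemma vanD d f g : van d f -> van d g -> van d (f + g).
Proof. by move=> vf vg m lt_md; apply: idlD; auto. Qed.

Lemma vanN d f : van d f -> van d (- f).
Proof. by move=> vf m lt_md; apply: idlN; auto. Qed.

(** If a monomial of degree less than [d + e] is split in two, the first part has degree below [d]
    or the second has degree below [e]. *)
Lemma vanM d e f g : vanishes_below (@zero_ideal A) d f -> van e g ->
  van (d + e) (f * g).
Proof.
move=> vf vg m lt_m; rewrite mpsME; apply: idl_sum => // -[k1 k2] /= /eqP mE.
have [lt_k1|le_k1] := ltnP (mdeg k1) d.
  by rewrite vf // mul0r; exact: idl0.
apply: idlMl => //; apply: vg.
by rewrite -(ltn_add2l d) (leq_ltn_trans _ lt_m) // [X in (_ <= mdeg X)%N]mE mdegD leq_add2r.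
Qed.

Lemma vanMl d f g : van d g -> van d (f * g).
Proof. by move=> vg; apply: (@vanM 0). Qed.

Lemma vanMr d f g : van d f -> van d (f * g).
Proof. by rewrite mulrC; exact: vanMl. Qed.

Lemma van_sum (J : Type) (r : seq J) (P : pred J) (E : J -> mps n A) d :
  (forall i, P i -> van d (E i)) -> van d (\sum_(i <- r | P i) E i).
Proof. by move=> vE; apply: big_ind => //; [exact: van0|move=> *; exact: vanD]. Qed.

Lemma van_leq d e f : (d <= e)%N -> van e f -> van d f.
Proof. by move=> le_de vf m lt_m; apply: vf; exact: leq_trans le_de. Qed.

Lemma vanC d c : I c -> van d (mpsC n c).
Proof. by rewrite /mpsC => Ic m _; case: eqP => _; rewrite ?mulr1n // mulr0n; exact: idl0. Qed.

Lemma van_zero d f : vanishes_below (@zero_ideal A) d f -> van d f.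
Proof. by move=> vf m /vf ->; exact: idl0. Qed.

(** The factors are exchanged one at a time. *)
Lemma van_prod (J : Type) (r : seq J) (E E' : J -> mps n A) d :
  (forall i, van d (E i - E' i)) ->
  van d (\prod_(i <- r) E i - \prod_(i <- r) E' i).
Proof.
move=> vE; elim: r => [|i r IHr]; first by rewrite !big_nil subrr; exact: van0.
rewrite !big_cons.
have -> (a b a' b' : mps n A) : a * b - a' * b' = (a - a') * b + a' * (b - b').
  by ring.
by apply: vanD; [exact: vanMr|exact: vanMl].
Qed.

Lemma vanB_trans d g f f' : van d (f - g) -> van d (g - f') -> van d (f - f').
Proof. by move=> vfg vge m lt_m; apply: (idl_sub_trans idI (vfg m lt_m) (vge m lt_m)). Qed.

Lemma vanB_sym d f g : van d (f - g) -> van d (g - f).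
Proof. by move=> /vanN; rewrite opprB. Qed.

Lemma vanBX d f g r : van d (f - g) -> van d (f ^+ r - g ^+ r).
Proof. by rewrite subrXX => vfg; exact: vanMr. Qed.

(* Raising to the power [r.+1] gains [r] degrees, as [f ^+ r.+1 - g ^+ r.+1]
   is [f - g] times a form of degree [r] in [f] and [g]. *)
Lemma vanBX_gain d f g r : f 0%MM = 0 -> g 0%MM = 0 ->
  van d (f - g) -> van (r + d) (f ^+ r.+1 - g ^+ r.+1).
Proof.
have v1 (u : mps n A) : u 0%MM = 0 -> vanishes_below (@zero_ideal A) 1 u.
  by move=> u0 m; rewrite ltnS leqn0 mdeg_eq0 => /eqP ->.
move=> /v1 vf /v1 vg vfg; elim: r => [|r IHr]; first by rewrite !expr1.
have -> : f ^+ r.+2 - g ^+ r.+2 = f * (f ^+ r.+1 - g ^+ r.+1) + g ^+ r.+1 * (f - g).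
  by rewrite !(exprS _ r.+1); ring.
apply: vanD; first exact: (@vanM 1 (r + d)).
elim: (r.+1) {IHr} => [|s IHs]; first by rewrite expr0 mul1r.
by rewrite exprS -mulrA; apply: (@vanM 1 (s + d)).
Qed.

End VanishesBelow.

Lemma van1P n (A : comNzRingType) (f : mps n A) :
  f 0%MM = 0 <-> vanishes_below (@zero_ideal A) 1 f.
Proof.
split=> [f0 m|]; last by apply; rewrite mdeg0.
by rewrite ltnS leqn0 mdeg_eq0 => /eqP ->.
Qed.

Lemma mps_eqP n (A : comNzRingType) (f g : mps n A) :
  (forall d, vanishes_below (@zero_ideal A) d (f - g)) -> f = g.
Proof.
move=> eq_fg; apply/funext => m; apply/eqP; rewrite -subr_eq0 -mpsBE.
by apply/eqP/(eq_fg (mdeg m).+1).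
Qed.

(** * Substitution *)

Section Composition.
Context (A : comNzRingType) (n r : nat).
Implicit Types (f g : mps n A) (G : n.-tuple (mps r A)).

Local Notation zvan := (vanishes_below (@zero_ideal A)).

(** Each coefficient of a substitution is that of a polynomial evaluation, so the algebraic laws can
    be imported from [mmap]. *)
Lemma mcomp_trunc f G m :
  mcomp f G m = mmap (mpsC r) (tnth G) (mps_trunc (mdeg m).+1 f) m.
Proof.
rewrite /mcomp /mps_trunc raddf_sum mps_sumE; apply: eq_bigr => k _.
by rewrite /= mmapZ mmapX /mmap1 mpsCM.
Qed.

(** Every factor lacks a constant term and so raises the degree by at least one. This is what makes
    the truncation in [mcomp] harmless. *)
Lemma van_mmap1 G (k : 'X_{1..n}) : (forall i, tnth G i 0%MM = 0) ->
  zvan (mdeg k) (mmap1 (tnth G) k).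
Proof.
move=> G0; have vX (u : mps r A) s : u 0%MM = 0 -> zvan s (u ^+ s).
  move=> u0; elim: s => [|s IHs] //; rewrite exprS.
  by apply: (@vanM _ _ _ (zero_is_ideal A) 1 s) => //; apply/van1P.
rewrite /mmap1 mdegE; elim/big_rec2: _ => // i d u _ vu.
by apply: vanM => //; [exact: zero_is_ideal|exact: vX].
Qed.

Lemma mmap_low (P Q : mpoly n A) G d m : (forall i, tnth G i 0%MM = 0) ->
  (mdeg m < d)%N -> (forall k, (mdeg k < d)%N -> P@_k = Q@_k) ->
  mmap (mpsC r) (tnth G) P m = mmap (mpsC r) (tnth G) Q m.
Proof.
move=> G0 lt_md eqPQ; apply/eqP; rewrite -subr_eq0 -mpsBE -raddfB /=.
rewrite /mmap mps_sumE big1_seq // => k _; rewrite mpsCM mcoeffB.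
have [lt_kd|le_dk] := ltnP (mdeg k) d; first by rewrite eqPQ // subrr mul0r.
by rewrite (van_mmap1 G0) ?mulr0 //; exact: leq_trans le_dk.
Qed.

(** The freedom in [P] matters for products: the product of two truncations is not the truncation of
    the product, but agrees with it in low degrees. *)
Lemma mcompE (P : mpoly n A) f G d m : (forall i, tnth G i 0%MM = 0) ->
  (mdeg m < d)%N -> (forall k, (mdeg k < d)%N -> P@_k = f k) ->
  mcomp f G m = mmap (mpsC r) (tnth G) P m.
Proof.
move=> G0 lt_md PE; rewrite mcomp_trunc.
apply: (@mmap_low _ _ _ (mdeg m).+1) => // k lt_k; rewrite mps_truncE // PE //.
by rewrite (leq_trans lt_k).
Qed.

Lemma mcompD f g G : mcomp (f + g) G = mcomp f G + mcomp g G.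
Proof.
apply/funext => m; rewrite mpsDE /mcomp -big_split.
by apply: eq_bigr => k _; rewrite mpsDE mulrDl.
Qed.

Lemma mcomp0l G : mcomp 0 G = 0.
Proof. by apply/funext => m; rewrite /mcomp big1 // => k _; rewrite mul0r. Qed.

Lemma mcomp_sum (J : Type) (s : seq J) (P : pred J) (E : J -> mps n A) G :
  mcomp (\sum_(i <- s | P i) E i) G = \sum_(i <- s | P i) mcomp (E i) G.
Proof.
exact: (big_morph ((@mcomp A n r)^~ G) (fun f g => mcompD f g G) (mcomp0l G)).
Qed.

Lemma mcompM f g G : (forall i, tnth G i 0%MM = 0) ->
  mcomp (f * g) G = mcomp f G * mcomp g G.
Proof.
move=> G0; apply/funext => m; set d := (mdeg m).+1.
rewrite (@mcompE (mps_trunc d f * mps_trunc d g) _ _ d) // => [|k lt_kd].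
  rewrite rmorphM /= !mpsME; apply: eq_bigr => -[k1 k2] /= _.
  by rewrite (@mcompE (mps_trunc d f) f _ d) ?(@mcompE (mps_trunc d g) g _ d) ?bmdeg //;
    move=> k lt_kd; rewrite mps_truncE.
rewrite (@mpsM_trunc _ _ (mdeg k).+1) //; apply: mcoeffM_eq => l le_lk.
  by rewrite !mps_truncE // (leq_ltn_trans le_lk).
by rewrite !mps_truncE // (leq_ltn_trans le_lk).
Qed.

Lemma mcompC c G : (forall i, tnth G i 0%MM = 0) -> mcomp (mpsC n c) G = mpsC r c.
Proof.
move=> G0; apply/funext => m.
rewrite (@mcompE (mpolyC n c) _ _ (mdeg m).+1) ?mmapC // => k _.
by rewrite mcoeffC /mpsC; case: eqP; rewrite ?mulr1 ?mulr0.
Qed.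

Lemma mcompX i G : (forall i, tnth G i 0%MM = 0) -> mcomp (mpsX A i) G = tnth G i.
Proof.
move=> G0; apply/funext => m.
rewrite (@mcompE 'X_i _ _ (mdeg m).+1) // ?mmapX ?mmap1U // => k _.
by rewrite mcoeffX /mpsX eq_sym.
Qed.

Lemma mcompXn f G s : (forall i, tnth G i 0%MM = 0) ->
  mcomp (f ^+ s) G = mcomp f G ^+ s.
Proof.
move=> G0; elim: s => [|s IHs]; first by rewrite !expr0 [LHS]mcompC.
by rewrite !exprS mcompM // IHs.
Qed.

Lemma mcomp_prod (J : Type) (s : seq J) (E : J -> mps n A) G :
  (forall i, tnth G i 0%MM = 0) ->
  mcomp (\prod_(i <- s) E i) G = \prod_(i <- s) mcomp (E i) G.
Proof.
move=> G0; elim: s => [|i s IHs]; first by rewrite !big_nil [LHS]mcompC.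
by rewrite !big_cons mcompM // IHs.
Qed.

Lemma mcomp_const f G : (forall i, tnth G i 0%MM = 0) ->
  mcomp f G 0%MM = f 0%MM.
Proof.
move=> G0; rewrite (@mcompE (mpolyC n (f 0%MM)) _ _ 1) ?mdeg0 // => [|k].
  by rewrite mmapC /= /mpsC eqxx mulr1n.
by rewrite ltnS leqn0 mdeg_eq0 => /eqP ->; rewrite mcoeffC eqxx mulr1.
Qed.

Lemma van_mcomp (I : A -> Prop) d f f' G G' : is_ideal I ->
  vanishes_below I d (f - f') ->
  (forall i, vanishes_below I d (tnth G i - tnth G' i)) ->
  vanishes_below I d (mcomp f G - mcomp f' G').
Proof.
move=> idI vf vG m lt_md; rewrite mpsBE /mcomp -sumrB.
apply: idl_sum => // k _.
have -> (a b a' b' : A) : a * b - a' * b' = (a - a') * b + a' * (b - b') by ring.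
apply: idlD => //.
  apply: idlMr => //; apply: vf; exact: leq_trans (bmdeg k) lt_md.
apply: idlMl => //; rewrite -mpsBE.
by apply: (van_prod idI) lt_md => i; exact: vanBX.
Qed.

End Composition.

(** Modulo degree [d] the series [f] may be replaced by a polynomial, and for a polynomial the
    identity says that substituting [K] commutes with sums, products and constants. *)
Lemma mcompA (A : comNzRingType) n r s (f : mps n A) (G : n.-tuple (mps r A))
    (K : r.-tuple (mps s A)) :
  (forall i, tnth G i 0%MM = 0) -> (forall i, tnth K i 0%MM = 0) ->
  mcomp (mcomp f G) K = mcomp f (map_tuple ((@mcomp A r s)^~ K) G).
Proof.
move=> G0 K0; apply: mps_eqP => d.
pose P := mps_trunc d f.
have GK0 i : tnth (map_tuple ((@mcomp A r s)^~ K) G) i 0%MM = 0.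
  by rewrite tnth_map mcomp_const.
have E t (L : n.-tuple (mps t A)) : (forall i, tnth L i 0%MM = 0) ->
    vanishes_below (@zero_ideal A) d (mcomp f L - mmap (mpsC t) (tnth L) P).
  move=> L0 m lt_md; rewrite mpsBE (@mcompE _ _ _ P _ _ d) // ?subrr // => k lt_kd.
  by rewrite mps_truncE.
apply: (vanB_trans (zero_is_ideal A) (g := mcomp (mmap (mpsC r) (tnth G) P) K)).
  apply: van_mcomp => [||i]; [exact: zero_is_ideal|exact: E|].
  by rewrite subrr; exact: van0 (zero_is_ideal A) _.
have -> : mcomp (mmap (mpsC r) (tnth G) P) K =
    mmap (mpsC s) (tnth (map_tuple ((@mcomp A r s)^~ K) G)) P.
  rewrite /mmap mcomp_sum; apply: eq_bigr => k _.
  rewrite mcompM // mcompC // /mmap1 mcomp_prod //; congr (_ * _).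
  by apply: eq_bigr => i _; rewrite mcompXn // tnth_map.
by apply: vanB_sym; [exact: zero_is_ideal|exact: E].
Qed.

(** * Change of coefficient ring *)

Section MapSeries.
Context (A B : comNzRingType) (j : {rmorphism A -> B}).

Fact map_mps_additive n : additive (map_mps j : mps n A -> mps n B).
Proof. by move=> f g; apply/funext => m; rewrite mpsBE /map_mps -rmorphB. Qed.

Fact map_mps_multiplicative n :
  monoid_morphism (map_mps j : mps n A -> mps n B).
Proof.
split=> [|f g]; apply/funext => m.
  by rewrite /map_mps [in RHS]/1 /= /mpsC rmorphMn rmorph1.
rewrite /map_mps !mpsME rmorph_sum /=.
by apply: eq_bigr => k _; rewrite rmorphM.
Qed.

HB.instance Definition _ n := GRing.isZmodMorphism.Build (mps n A) (mps n B)
  (map_mps j) (@map_mps_additive n).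
HB.instance Definition _ n := GRing.isMonoidMorphism.Build (mps n A) (mps n B)
  (map_mps j) (@map_mps_multiplicative n).

Lemma map_mpsC n c : map_mps j (mpsC n c) = mpsC n (j c).
Proof. by apply/funext => m; rewrite /map_mps /mpsC rmorphMn. Qed.

Lemma map_mpsX n (i : 'I_n) : map_mps j (mpsX A i) = mpsX B i.
Proof. by apply/funext => m; rewrite /map_mps /mpsX rmorph_nat. Qed.

Lemma map_mcomp n r (f : mps n A) (G : n.-tuple (mps r A)) :
  map_mps j (mcomp f G) = mcomp (map_mps j f) (map_tuple (map_mps j) G).
Proof.
apply/funext => m; rewrite /map_mps /mcomp rmorph_sum /=.
apply: eq_bigr => k _; rewrite rmorphM; congr (_ * _).
rewrite -[LHS]/(map_mps j _ m) rmorph_prod.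
by congr ((_ : mps r B) m); apply: eq_bigr => i _; rewrite rmorphXn tnth_map.
Qed.

End MapSeries.

Lemma tuple1_const0 r (A : comNzRingType) (a : mps r A) : a 0%MM = 0 ->
  forall i, tnth [tuple a] i 0%MM = 0.
Proof. by move=> a0 i; rewrite (tnth_nth 0) ord1. Qed.

Lemma tuple2_const0 r (A : comNzRingType) (a b : mps r A) :
  a 0%MM = 0 -> b 0%MM = 0 -> forall i, tnth [tuple a; b] i 0%MM = 0.
Proof. by move=> a0 b0 [[|[|i]] lti] //=; rewrite (tnth_nth 0). Qed.

Lemma mpsX_const0 n (A : comNzRingType) (i : 'I_n) : mpsX A i 0%MM = 0.
Proof. by rewrite /mpsX eq_sym mnm1_eq0. Qed.

Lemma mcomp1A (A : comNzRingType) r s (f : mps 1 A) (a : mps r A)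
    (K : r.-tuple (mps s A)) :
  a 0%MM = 0 -> (forall i, tnth K i 0%MM = 0) ->
  mcomp (mcomp f [tuple a]) K = mcomp f [tuple mcomp a K].
Proof.
move=> a0 K0; rewrite mcompA //; last exact: tuple1_const0.
by congr mcomp; apply: val_inj.
Qed.

Lemma mcomp2A (A : comNzRingType) r s (f : mps 2 A) (a b : mps r A)
    (K : r.-tuple (mps s A)) :
  a 0%MM = 0 -> b 0%MM = 0 -> (forall i, tnth K i 0%MM = 0) ->
  mcomp (fadd f a b) K = fadd f (mcomp a K) (mcomp b K).
Proof.
move=> a0 b0 K0; rewrite /fadd mcompA //; last exact: tuple2_const0.
by congr mcomp; apply: val_inj.
Qed.

Lemma map_mcomp1 (A B : comNzRingType) (j : {rmorphism A -> B}) r (f : mps 1 A)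
    (a : mps r A) :
  map_mps j (mcomp f [tuple a]) = mcomp (map_mps j f) [tuple map_mps j a].
Proof. by rewrite map_mcomp; congr mcomp; apply: val_inj. Qed.

Lemma map_fadd (A B : comNzRingType) (j : {rmorphism A -> B}) r (F : mps 2 A)
    (a b : mps r A) :
  map_mps j (fadd F a b) = fadd (map_mps j F) (map_mps j a) (map_mps j b).
Proof. by rewrite /fadd map_mcomp; congr mcomp; apply: val_inj. Qed.

Lemma mcomp0r (A : comNzRingType) r (f : mps 1 A) : f 0%MM = 0 ->
  mcomp f [tuple 0 : mps r A] = 0.
Proof.
move=> f0; apply/funext => m; rewrite /mcomp big1 // => k _.
rewrite big_ord1 (tnth_nth 0) /= expr0n.
case: eqP => [k0|_]; last by rewrite mulr0.
suff -> : (k : 'X_{1..1}) = 0%MM by rewrite f0 mul0r.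
by apply/mnmP => i; rewrite ord1 k0 mnm0E.
Qed.

(** In one variable a monomial is determined by its degree, so coefficients can be read off by a
    test on [mdeg]. *)
Lemma mpsXn_coef (A : comNzRingType) (i : 'I_1) s (m : 'X_{1..1}) :
  (mpsX A i ^+ s) m = (mdeg m == s)%:R.
Proof.
transitivity (('X_i ^+ s : mpoly 1 A)@_m).
  elim: s m => [|s IHs] m; first by rewrite !expr0 mcoeff1.
  rewrite !exprS (@mpsM_trunc _ _ (mdeg m).+1) //.
  apply: mcoeffM_eq => k le_km; rewrite mps_truncE //.
  by rewrite mcoeffX /mpsX eq_sym.
rewrite mpolyXn mcoeffX; congr (_%:R); congr nat_of_bool.
apply/eqP/eqP => [<-|ms]; first by rewrite mdegMn mdeg1 mul1n.
apply/mnmP => j; rewrite mulmnE -ms mdegE big_ord1 (ord1 i) (ord1 j).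
by rewrite mnm1E eqxx mul1n.
Qed.

Lemma mcomp_id (A : comNzRingType) (f : mps 1 A) :
  mcomp f [tuple mpsX A ord0] = f.
Proof.
apply/funext => m; rewrite /mcomp (bigD1 (BMultinom (ltnSn (mdeg m)))) //=.
rewrite big_ord1 mpsXn_coef {1}mdegE big_ord1 eqxx mulr1 big1 ?addr0 // => k km.
rewrite big_ord1 mpsXn_coef; case: eqP => [mk|_]; last by rewrite mulr0.
case/eqP: km; apply: val_inj; apply/mnmP => i /=.
by rewrite !ord1 -mk mdegE big_ord1.
Qed.

Lemma van_affine_part (A : comNzRingType) (f : mps 1 A) :
  vanishes_below (@zero_ideal A) 2
    (f - mpsC 1 (f 0%MM) - mpsC 1 (f U_(ord0)%MM) * mpsX A ord0).
Proof.
move=> m; rewrite !mpsBE mpsCM; case: (posnP (mdeg m)) => [/eqP|m_gt0 m_lt2].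
  by rewrite mdeg_eq0 => /eqP -> _; rewrite mpsX_const0 mulr0 /mpsC eqxx subrr subr0.
have /mdeg1P[i /eqP ->] : mdeg m == 1%N by rewrite eqn_leq -ltnS m_lt2.
rewrite ord1 mpsX_coef eqxx mulr1 /mpsC mnm1_eq0 mulr0n subr0.
exact: subrr.
Qed.

(** * The linear term of a substitution, and cancellation *)

Section LeadingCoefficient.
Context (A : comNzRingType) (I : A -> Prop) (idI : is_ideal I) (r : nat).
Implicit Types (h : mps 1 A) (a b : mps r A).

(** The affine part of [h] contributes exactly its linear coefficient times [a - b]. A term of
    degree [s >= 2] contributes a multiple of [a ^+ s - b ^+ s], which gains [s - 1 >= 1] degrees
    over [a - b]. *)
Lemma mcomp_leading h a b e : a 0%MM = 0 -> b 0%MM = 0 ->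
  vanishes_below I e (a - b) ->
  vanishes_below I e.+1 (mcomp h [tuple a] - mcomp h [tuple b]
                         - mpsC r (h U_(ord0)%MM) * (a - b)).
Proof.
move=> a0 b0 vab; set h1 := h _.
have Ka := tuple1_const0 a0; have Kb := tuple1_const0 b0.
pose x : mps 1 A := mpsX A ord0.
pose h' := h - mpsC 1 (h 0%MM) - mpsC 1 h1 * x.
have h'_low : vanishes_below (@zero_ideal A) 2 h' by exact: van_affine_part.
have hE : h = h' + mpsC 1 (h 0%MM) + mpsC 1 h1 * x by rewrite /h'; ring.
have compE (c : mps r A) : c 0%MM = 0 ->
    mcomp h [tuple c] = mcomp h' [tuple c] + mpsC r (h 0%MM) + mpsC r h1 * c.
  by move=> /tuple1_const0 c0; rewrite {1}hE !mcompD mcompM // !mcompC // mcompX //.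
rewrite !compE //.
have -> (u v c d1 : mps r A) :
  u + c + d1 * a - (v + c + d1 * b) - d1 * (a - b) = u - v by ring.
move=> m lt_m; rewrite mpsBE /mcomp -sumrB; apply: idl_sum => // k _.
rewrite -mulrBr; have [k_lt2|k_ge2] := ltnP (mdeg k) 2.
  by rewrite h'_low // mul0r; exact: idl0.
apply: idlMl => //; rewrite !big_ord1 !(tnth_nth 0) /= -mpsBE.
move: k_ge2; rewrite mdegE big_ord1; case: (_ ord0) => [|[|s]] // _.
apply: (vanBX_gain (r := s.+1) idI a0 b0 vab).
by rewrite (leq_trans lt_m) // addSn ltnS leq_addl.
Qed.

Lemma mcomp_leading0 h a e : h 0%MM = 0 -> a 0%MM = 0 ->
  vanishes_below I e a ->
  vanishes_below I e.+1 (mcomp h [tuple a] - mpsC r (h U_(ord0)%MM) * a).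
Proof.
move=> h0 a0 va; have va0 : vanishes_below I e (a - 0) by rewrite subr0.
have := mcomp_leading h a0 (mps0E A 0%MM) va0.
by rewrite mcomp0r // !subr0.
Qed.

(** Induction on the degree: modulo [I], the lowest part of [a - b] is seen in the difference of the
    composites multiplied by the linear coefficient of [h], which has inverse [u]. *)
Lemma mcomp_inj_mod h a b d u : a 0%MM = 0 -> b 0%MM = 0 ->
  u * h U_(ord0)%MM = 1 ->
  vanishes_below I d (mcomp h [tuple a] - mcomp h [tuple b]) ->
  vanishes_below I d (a - b).
Proof.
move=> a0 b0 uh vh; suff ve e : (e <= d)%N -> vanishes_below I e (a - b) by exact: ve.
elim: e => [|e IHe] lt_ed // m lt_me.
have := mcomp_leading h a0 b0 (IHe (ltnW lt_ed)) lt_me.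
have := vh m (leq_trans lt_me lt_ed).
move=> Ih Il; have := idlB idI Ih Il; rewrite [X in I (_ - X)]mpsBE subKr mpsCM.
by move=> /(idlMl idI u); rewrite mulrA uh mul1r.
Qed.

End LeadingCoefficient.

Lemma comp_inverse_leading (A : comNzRingType) (f f' : mps 1 A) :
  comp_inverse f f' -> f U_(ord0)%MM * f' U_(ord0)%MM = 1.
Proof.
case=> f0 f'0 ff' _; have /van1P f'v1 := f'0.
have lt12 : (@mdeg 1 U_(ord0)%MM < 2)%N by rewrite mdeg1.
have := mcomp_leading0 (zero_is_ideal A) f0 f'0 f'v1 lt12.
by rewrite ff' mpsBE mpsCM mpsX_coef eqxx => /eqP; rewrite subr_eq0 => /eqP <-.
Qed.

(** * Formal group laws *)

Section FormalGroupLaw.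
Context (A : comNzRingType) (I : A -> Prop) (idI : is_ideal I).
Context (F : mps 2 A) (fglF : is_fgl F).

Lemma fgl_const0 : F 0%MM = 0.
Proof.
have K0 := tuple2_const0 (mpsX_const0 A (ord0 : 'I_1)) (mps0E A 0%MM).
rewrite -(mcomp_const F K0); case: fglF => -> _ _ _; exact: mpsX_const0.
Qed.

Section Fadd.
Context (r : nat).
Implicit Types (a b : mps r A).

Lemma fadd_const0 a b : a 0%MM = 0 -> b 0%MM = 0 -> fadd F a b 0%MM = 0.
Proof.
by move=> a0 b0; rewrite /fadd mcomp_const ?fgl_const0 //; exact: tuple2_const0.
Qed.

Lemma faddr0 a : a 0%MM = 0 -> fadd F a 0 = a.
Proof.
move=> a0; case: fglF => F0 _ _ _; have K0 := tuple1_const0 a0.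
have := congr1 (fun f : mps 1 A => mcomp f [tuple a]) F0.
by rewrite [mcomp F _]/(fadd F _ _) mcomp2A ?mpsX_const0 // mcomp0l mcompX.
Qed.

Lemma fadd0r a : a 0%MM = 0 -> fadd F 0 a = a.
Proof.
move=> a0; case: fglF => _ F0 _ _; have K0 := tuple1_const0 a0.
have := congr1 (fun f : mps 1 A => mcomp f [tuple a]) F0.
by rewrite [mcomp F _]/(fadd F _ _) mcomp2A ?mpsX_const0 // mcomp0l mcompX.
Qed.

Lemma van_fadd d a a' b b' :
  vanishes_below I d (a - a') -> vanishes_below I d (b - b') ->
  vanishes_below I d (fadd F a b - fadd F a' b').
Proof.
move=> va vb; apply: van_mcomp => //; first by rewrite subrr; exact: van0.
by case=> -[|[|i]] lti //; rewrite !(tnth_nth 0).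
Qed.

Lemma fsumS (a : nat -> mps r A) n :
  fsum F a n.+1 = fadd F (a 0%N) (fsum F (a \o S) n).
Proof. by rewrite /fsum /mkseq /= -[1%N]addn0 iotaDl -map_comp. Qed.

Lemma fsum_const0 (a : nat -> mps r A) n :
  (forall i, a i 0%MM = 0) -> fsum F a n 0%MM = 0.
Proof.
elim: n a => [|n IHn] a a0 //; rewrite fsumS; apply: fadd_const0 => //.
by apply: IHn => i; exact: a0.
Qed.

Lemma van_fsum d (a : nat -> mps r A) n :
  (forall i, vanishes_below I d (a i)) -> vanishes_below I d (fsum F a n).
Proof.
elim: n a => [|n IHn] a va; first exact: van0.
have va0 : vanishes_below I d (a 0%N - 0) by rewrite subr0.
have vaS : vanishes_below I d (fsum F (a \o S) n - 0).
  by rewrite subr0; apply: IHn => i; exact: va.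
by have := van_fadd va0 vaS; rewrite -fsumS faddr0 // subr0.
Qed.

(** Modulo [I] and degree [d] all earlier summands are the neutral element of the formal sum. *)
Lemma fsum_last d (a : nat -> mps r A) n : a n 0%MM = 0 ->
  (forall i, (i < n)%N -> vanishes_below I d (a i)) ->
  vanishes_below I d (fsum F a n.+1 - a n).
Proof.
elim: n a => [|n IHn] a a0 va; rewrite fsumS.
  by rewrite faddr0 // subrr; exact: van0.
rewrite -[X in _ - X](fadd0r a0); apply: van_fadd; first by rewrite subr0; exact: va.
by apply: IHn => // i lt_in; exact: va.
Qed.

End Fadd.
End FormalGroupLaw.

Lemma van_mpsXn (A : comNzRingType) (i : 'I_1) s :
  vanishes_below (@zero_ideal A) s (mpsX A i ^+ s).
Proof. by move=> m lt_ms; rewrite mpsXn_coef /zero_ideal ltn_eqF. Qed.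

(** * The p-series of the universal p-typical law *)

Lemma big_ord_support (V : nmodType) a b (c : nat -> V) : (a <= b)%N ->
  (forall i, (a <= i)%N -> c i = 0) -> \sum_(i < b) c i = \sum_(i < a) c i.
Proof.
move=> le_ab c0; rewrite -!(big_mkord xpredT) (@big_cat_nat _ _ _ a) //=.
by rewrite [X in _ + X]big_nat [X in _ + X]big1 ?addr0 // => i /andP[/c0].
Qed.

(** Both sides sum over the pairs with [i + j < N], on the left by antidiagonals and on the right by
    rows. *)
Lemma big_triangle (V : nmodType) N (T : nat -> nat -> V) :
  \sum_(m < N) \sum_(i < m.+1) T i (m - i)%N
    = \sum_(i < N) \sum_(j < N - i) T i j.
Proof.
elim: N => [|N IHN]; first by rewrite !big_ord0.
rewrite big_ord_recr IHN /=.
transitivity (\sum_(i < N.+1) (\sum_(j < N - i) T i j + T i (N - i)%N)).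
  by rewrite big_split [X in _ = X + _]big_ord_recr /= subnn big_ord0 addr0.
apply: eq_bigr => i _; rewrite subSn ?big_ord_recr //.
by rewrite -ltnS.
Qed.

Section Logarithm.
Context (A : comNzRingType) (p : nat) (p_gt1 : (1 < p)%N).
Context (l v : nat -> A) (l0 : l 0%N = 1).
Hypothesis araki :
  forall n, p%:R * l n = \sum_(i < n.+1) l i * v (n - i)%N ^+ (p ^ i).

Local Notation zvan := (vanishes_below (@zero_ideal A)).
Local Notation L := (plog p l).
Local Notation x := (mpsX A (ord0 : 'I_1)).
Let idZ := zero_is_ideal A.

Lemma plog_const0 : L 0%MM = 0.
Proof.
rewrite /plog mdeg0 big_pred0 // => i; apply/negbTE.
by rewrite eq_sym -lt0n expn_gt0 (ltn_trans _ p_gt1).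
Qed.

Lemma plog_coef1 : L U_(ord0)%MM = 1.
Proof.
rewrite /plog mdeg1 big_mkcond !big_ord_recl big_ord0 /= l0 addr0.
by rewrite eq_sym eqn_leq expn1 [(p <= 1)%N]leqNgt p_gt1 addr0.
Qed.

Lemma van_plog n :
  zvan (p ^ n).+1 (L - \sum_(i < n.+1) mpsC 1 (l i) * x ^+ (p ^ i)).
Proof.
move=> m; rewrite ltnS mpsBE => le_mn.
pose c i := if mdeg m == (p ^ i)%N then l i else 0.
have -> : L m = \sum_(i < (mdeg m).+1) c i by rewrite /plog big_mkcond.
have -> : (\sum_(i < n.+1) mpsC 1 (l i) * x ^+ (p ^ i)) m = \sum_(i < n.+1) c i.
  rewrite mps_sumE; apply: eq_bigr => i _; rewrite mpsCM mpsXn_coef /c.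
  by case: eqP => _; rewrite ?mulr1 ?mulr0.
apply/eqP; rewrite subr_eq0; apply/eqP.
rewrite -(@big_ord_support _ (mdeg m).+1 ((mdeg m).+1 + n.+1) c) ?leq_addr //.
  rewrite -(@big_ord_support _ n.+1 ((mdeg m).+1 + n.+1) c) ?leq_addl // => i lt_ni.
  rewrite /c ltn_eqF // (leq_ltn_trans le_mn) // ltn_exp2l //.
move=> i lt_mi; rewrite /c ltn_eqF // (ltn_trans lt_mi) //; exact: ltn_expl.
Qed.

Lemma van_mcomp_plog (a : mps 1 A) n : a 0%MM = 0 ->
  zvan (p ^ n).+1 (mcomp L [tuple a] - \sum_(i < n.+1) mpsC 1 (l i) * a ^+ (p ^ i)).
Proof.
move=> /tuple1_const0 a0.
have -> : \sum_(i < n.+1) mpsC 1 (l i) * a ^+ (p ^ i)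
    = mcomp (\sum_(i < n.+1) mpsC 1 (l i) * x ^+ (p ^ i)) [tuple a].
  rewrite mcomp_sum; apply: eq_bigr => i _.
  by rewrite mcompM // mcompC // mcompXn // mcompX.
apply: van_mcomp => //; first exact: van_plog.
by move=> i; rewrite subrr; exact: van0.
Qed.

Variable G : mps 2 A.
Hypothesis fglG : is_fgl G.
Hypothesis plogG : mcomp L [tuple G] =
  mcomp L [tuple mpsX A (0 : 'I_2)] + mcomp L [tuple mpsX A (1 : 'I_2)].

Lemma plog_fadd (a b : mps 1 A) : a 0%MM = 0 -> b 0%MM = 0 ->
  mcomp L [tuple fadd G a b] = mcomp L [tuple a] + mcomp L [tuple b].
Proof.
move=> a0 b0; have K0 := tuple2_const0 a0 b0.
rewrite /fadd -mcomp1A ?(fgl_const0 fglG) // plogG mcompD.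
by rewrite !mcomp1A ?mpsX_const0 // !mcompX.
Qed.

Lemma plog_fsum (a : nat -> mps 1 A) n : (forall i, a i 0%MM = 0) ->
  mcomp L [tuple fsum G a n] = \sum_(i < n) mcomp L [tuple a i].
Proof.
elim: n a => [|n IHn] a a0; first by rewrite big_ord0 mcomp0r // plog_const0.
rewrite fsumS plog_fadd // ?big_ord_recl ?IHn // => [i|]; first exact: a0.
by apply: fsum_const0 => // i; exact: a0.
Qed.

(* The identity [p log x = sum_j log (v_j x^(p^j))], read off the defining
   equation of the Araki generators. *)
Lemma van_pseries_araki n :
  zvan (p ^ n).+1
    (nseries G p - fsum G (fun j => mpsC 1 (v j) * x ^+ (p ^ j)) n.+1).
Proof.
pose s j := mpsC 1 (v j) * x ^+ (p ^ j).
have p_exp_gt0 j : (0 < p ^ j)%N by rewrite expn_gt0 (ltn_trans _ p_gt1).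
have s0 j : s j 0%MM = 0.
  by rewrite /s mpsCM mpsXn_coef mdeg0 ltn_eqF // mulr0.
have x0 : x 0%MM = 0 by exact: mpsX_const0.
(* The logarithm has linear coefficient 1, so it can be cancelled and it suffices to compare the
   logarithms of the two sides. *)
apply: (@mcomp_inj_mod _ _ idZ _ L _ _ _ 1); rewrite ?plog_coef1 ?mulr1 //.
- exact: fsum_const0.
- exact: fsum_const0.
rewrite !plog_fsum // sumr_const card_ord.
pose T i j := mpsC 1 (l i * v j ^+ (p ^ i)) * x ^+ (p ^ (i + j)).
have sE i j : mpsC 1 (l i) * s j ^+ (p ^ i) = T i j.
  by rewrite /s /T exprMn -rmorphXn mulrA -rmorphM -exprM -expnD addnC.
pose Lx := \sum_(i < n.+1) mpsC 1 (l i) * x ^+ (p ^ i).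
(* The Araki relations for indices up to [n] give the terms [T i j] in the triangle [i + j <= n]. *)
have LxE : Lx *+ p = \sum_(i < n.+1) \sum_(j < n.+1 - i) T i j.
  rewrite -big_triangle /Lx -sumrMnl; apply: eq_bigr => m _.
  rewrite -mulrnAl -rmorphMn /= -mulr_natl araki rmorph_sum /= mulr_suml.
  apply: eq_bigr => i _; rewrite /T subnKC //.
  by rewrite -ltnS.
apply: (vanB_trans idZ (g := Lx *+ p)).
  rewrite -mulrnBl -mulr_natl; apply: vanMl => //.
  exact: van_mcomp_plog.
(* The logarithms of the [s j] give the full square [i, j <= n] instead of the triangle. *)
apply: (vanB_trans idZ (g := \sum_(j < n.+1) \sum_(i < n.+1) T i j)); last first.
  rewrite -sumrB; apply: van_sum => // j _; apply: vanB_sym => //.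
  under eq_bigr do rewrite -sE.
  by apply: van_mcomp_plog; exact: s0.
(* What the square has beyond the triangle satisfies [i + j > n], so its terms lie in degree at
   least [p ^ n.+1]. *)
rewrite LxE exchange_big -sumrB /=; apply: van_sum => // i _.
rewrite -!(big_mkord xpredT) (@big_cat_nat _ _ _ (n.+1 - i) 0 n.+1) ?leq_subr //=.
rewrite opprD addrA subrr add0r; apply: vanN => //.
rewrite big_nat; apply: van_sum => // j /andP[le_j _].
apply: vanMl => //.
apply: (@van_leq _ _ _ _ (p ^ (i + j))); last exact: van_mpsXn.
by rewrite ltn_exp2l // -leq_subLR.
Qed.

End Logarithm.

(** * The embedding of the p-local coefficients into the rational ones *)

Section VZtoVQ.
Context (p : nat).
Implicit Types (P Q : VZ p).

Let zval : {rmorphism Zloc p -> rat} := (\val : Zloc p -> rat).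

Lemma VZ_to_VQ_coef P m :
  monalg.mcoeff m (VZ_to_VQ P) = zval (monalg.mcoeff m P).
Proof.
rewrite /VZ_to_VQ raddf_sum /=.
under eq_bigr do rewrite monalg.mcoeffU.
have [mP|mP] := boolP (m \in monalg.msupp P).
  rewrite (bigD1_seq m) //= ?fset_uniq // eqxx big1 ?addr0 // => k /negbTE -> //.
rewrite (monalg.mcoeff_outdom mP) -[RHS]/(zval 0) rmorph0.
rewrite big1_seq // => k /= kP.
by case: eqP => // km; rewrite -km kP in mP.
Qed.

Lemma VZ_to_VQ_supp P :
  (monalg.msupp (VZ_to_VQ P) `<=` monalg.msupp P)%fset.
Proof.
apply/fsubsetP => m; rewrite -!monalg.mcoeff_neq0 VZ_to_VQ_coef.
by apply: contra_neq => ->; exact: (rmorph0 zval).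
Qed.

Fact VZ_to_VQ_additive : additive (@VZ_to_VQ p).
Proof.
move=> P Q; apply/monalg.malgP => m.
rewrite (VZ_to_VQ_coef (P - Q)) [RHS]monalg.mcoeffB.
transitivity (zval (monalg.mcoeff m P) - zval (monalg.mcoeff m Q)).
  by rewrite -(rmorphB zval); congr (zval _); exact: (monalg.mcoeffB m P Q).
by congr (_ - _); rewrite VZ_to_VQ_coef.
Qed.

Fact VZ_to_VQ_multiplicative : monoid_morphism (@VZ_to_VQ p).
Proof.
split=> [|P Q]; apply/monalg.malgP => m; rewrite VZ_to_VQ_coef.
  by rewrite !monalg.mcoeff1 rmorph_nat.
(* Both products are expanded over the supports of [P] and [Q], so that the two double sums have the
   same index sets. *)
rewrite (monalg.mcoeffMlw _ (VZ_to_VQ_supp P) (VZ_to_VQ_supp Q)).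
rewrite (monalg.mcoeffMlw _ (fsubset_refl _) (fsubset_refl _)) (rmorph_sum zval).
apply: eq_bigr => k1 _; rewrite (rmorph_sum zval); apply: eq_bigr => k2 _.
by rewrite !VZ_to_VQ_coef (rmorphMn zval) (rmorphM zval).
Qed.

HB.instance Definition _ :=
  GRing.isZmodMorphism.Build (VZ p) VQ (@VZ_to_VQ p) VZ_to_VQ_additive.
HB.instance Definition _ :=
  GRing.isMonoidMorphism.Build (VZ p) VQ (@VZ_to_VQ p) VZ_to_VQ_multiplicative.

Lemma VZ_to_VQ_inj : injective (@VZ_to_VQ p).
Proof.
move=> P Q eqPQ; apply/monalg.malgP => m; apply: val_inj.
by apply: etrans (VZ_to_VQ_coef Q m); rewrite -eqPQ VZ_to_VQ_coef.
Qed.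

Lemma VZ_to_VQ_gen i : VZ_to_VQ (vZ p i) = vQ p i.
Proof.
case: i => [|i]; first exact: rmorph_nat.
apply/monalg.malgP => m; rewrite VZ_to_VQ_coef !monalg.mcoeffU.
by rewrite rmorphMn rmorph1.
Qed.

End VZtoVQ.

Lemma map_fgl (A B : comNzRingType) (j : {rmorphism A -> B}) (F : mps 2 A) :
  is_fgl F -> is_fgl (map_mps j F).
Proof.
have faddE C n (F' : mps 2 C) (a b : mps n C) : mcomp F' [tuple a; b] = fadd F' a b by [].
case=> + + + /=; rewrite !faddE => F0 F1 FC FA.
split; rewrite /= !faddE.
- by rewrite -(map_mpsX j) -(rmorph0 (map_mps j)) -map_fadd F0.
- by rewrite -(map_mpsX j) -(rmorph0 (map_mps j)) -map_fadd F1.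
- by rewrite -!(map_mpsX j) -map_fadd FC.
- by rewrite -!(map_mpsX j) -!map_fadd FA.
Qed.

Lemma map_fsum (A B : comNzRingType) (j : {rmorphism A -> B}) n (F : mps 2 A)
    (a : nat -> mps n A) r :
  map_mps j (fsum F a r) = fsum (map_mps j F) (fun i => map_mps j (a i)) r.
Proof.
elim: r a => [|r IHr] a; first exact: rmorph0.
by rewrite !fsumS map_fadd IHr.
Qed.

Lemma map_nseries (A B : comNzRingType) (j : {rmorphism A -> B}) (F : mps 2 A) r :
  map_mps j (nseries F r) = nseries (map_mps j F) r.
Proof. by rewrite /nseries map_fsum map_mpsX. Qed.

Lemma van_map_mps (A B : comNzRingType) (j : {rmorphism A -> B}) n d
    (f : mps n A) :
  vanishes_below (@zero_ideal A) d f ->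
  vanishes_below (@zero_ideal B) d (map_mps j f).
Proof. by move=> vf m /vf; rewrite /zero_ideal /map_mps => ->; rewrite rmorph0. Qed.

(** The logarithm exists only over [VQ], because the [l_i] have denominators. The congruence is
    proved there and descends, since [VZ_to_VQ] is injective and compatible with formal sums. *)
Lemma universal_pseries (p : nat) (G : mps 2 (VZ p)) n : (1 < p)%N ->
  is_universal_ptypical G ->
  vanishes_below (@zero_ideal (VZ p)) (p ^ n).+1
    (nseries G p
     - fsum G (fun j => mpsC 1 (vZ p j) * mpsX _ ord0 ^+ (p ^ j)) n.+1).
Proof.
move=> p_gt1 [fglG [l [[l0 araki] plogG]]].
pose s j : mps 1 (VZ p) := mpsC 1 (vZ p j) * mpsX (VZ p) ord0 ^+ (p ^ j).
have sE j : map_mps (@VZ_to_VQ p) (s j) = mpsC 1 (vQ p j) * mpsX VQ ord0 ^+ (p ^ j).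
  by rewrite rmorphM rmorphXn /= map_mpsC map_mpsX -(VZ_to_VQ_gen p j).
have vn : vanishes_below (@zero_ideal VQ) (p ^ n).+1
    (map_mps (@VZ_to_VQ p) (nseries G p - fsum G s n.+1)).
  rewrite rmorphB /= (map_nseries (@VZ_to_VQ p)) (map_fsum (@VZ_to_VQ p)) (funext sE).
  exact: (van_pseries_araki p_gt1 l0 araki (map_fgl (@VZ_to_VQ p) fglG) plogG).
move=> m lt_m; apply: (@VZ_to_VQ_inj p); rewrite (rmorph0 (@VZ_to_VQ p)).
exact: vn.
Qed.

(** * Homomorphisms and their leading coefficient *)

Section Homomorphisms.
Context (A : comNzRingType).
Implicit Types (F : mps 2 A) (f : mps 1 A).

Lemma fgl_hom_fadd F1 F2 f r (a b : mps r A) : F1 0%MM = 0 ->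
  fgl_hom F1 F2 f -> a 0%MM = 0 -> b 0%MM = 0 ->
  mcomp f [tuple fadd F1 a b] = fadd F2 (mcomp f [tuple a]) (mcomp f [tuple b]).
Proof.
move=> F10 [f0 fF] a0 b0; have K0 := tuple2_const0 a0 b0.
rewrite /fadd -mcomp1A // fF mcomp2A //.
- by rewrite !mcomp1A ?mpsX_const0 // !mcompX.
- by rewrite mcomp_const //; exact/tuple1_const0/mpsX_const0.
- by rewrite mcomp_const //; exact/tuple1_const0/mpsX_const0.
Qed.

Lemma nseriesS F r : nseries F r.+1 = fadd F (mpsX A ord0) (nseries F r).
Proof. exact: fsumS. Qed.

Lemma nseries_const0 F r : is_fgl F -> nseries F r 0%MM = 0.
Proof. by move=> fglF; apply: fsum_const0 => // _; exact: mpsX_const0. Qed.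

Lemma fgl_hom_nseries F1 F2 f r : is_fgl F1 -> is_fgl F2 -> fgl_hom F1 F2 f ->
  mcomp f [tuple nseries F1 r] = mcomp (nseries F2 r) [tuple f].
Proof.
move=> fgl1 fgl2 hf; have [f0 _] := hf; have K0 := tuple1_const0 f0.
have x0 : mpsX A (ord0 : 'I_1) 0%MM = 0 by exact: mpsX_const0.
elim: r => [|r IHr]; first by rewrite mcomp0r // mcomp0l.
rewrite !nseriesS (fgl_hom_fadd _ hf) ?(fgl_const0 fgl1) ?nseries_const0 //.
by rewrite mcomp2A ?nseries_const0 // IHr mcompX // mcomp_id.
Qed.

(* The twist of [F] by [g] is the law which makes [g] a homomorphism to [F]. *)
Lemma fgl_hom_twist F1 F f (g g' : mps 1 A) : is_fgl F1 -> is_fgl F ->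
  comp_inverse g g' ->
  fgl_hom F1 (mcomp g' [tuple fadd F (mcomp g [tuple mpsX A (0 : 'I_2)])
                                     (mcomp g [tuple mpsX A (1 : 'I_2)])]) f ->
  fgl_hom F1 F (mcomp g [tuple f]).
Proof.
move=> fgl1 fglF [g0 g'0 gg' _] [f0 fF]; have x0 := @mpsX_const0 2 A.
have g_const0 r (a : mps r A) : a 0%MM = 0 -> mcomp g [tuple a] 0%MM = 0.
  by move=> a0; rewrite mcomp_const //; exact: tuple1_const0.
have f_const0 i : mcomp f [tuple mpsX A (i : 'I_2)] 0%MM = 0.
  by rewrite mcomp_const //; exact: tuple1_const0.
have F10 := tuple1_const0 (fgl_const0 fgl1).
split; first exact: g_const0.
have K0 := tuple2_const0 (f_const0 0) (f_const0 1).
rewrite mcomp1A // fF [fadd (mcomp g' _) _ _]/fadd mcomp1A //; last first.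
  by apply: (fadd_const0 fglF); exact: g_const0.
pose a i := mcomp g [tuple mcomp f [tuple mpsX A (i : 'I_2)]].
have a0 i : a i 0%MM = 0 by exact/g_const0/f_const0.
have F0 := tuple1_const0 (fadd_const0 fglF (a0 0) (a0 1)).
have gfE i : mcomp (mcomp g [tuple f]) [tuple mpsX A i] = a i.
  by rewrite mcomp1A //; exact: tuple1_const0.
rewrite !gfE mcomp2A ?g_const0 // (mcomp1A g (x0 0) K0) (mcomp1A g (x0 1) K0).
by rewrite !mcompX // -mcomp1A // gg' mcompX.
Qed.

(** The summands of index [i >= 1] start in degree [p ^ i >= 2], so only the first one reaches the
    linear coefficient. For [h_g] this identifies [t_0]. *)
Lemma infinite_fsum_leading p F (t : nat -> A) s : (1 < p)%N -> is_fgl F ->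
  is_infinite_fsum F (fun i => mpsC 1 (t i) * mpsX A ord0 ^+ (p ^ i)) s ->
  s U_(ord0)%MM = t 0%N.
Proof.
(* The stationary rank [N] is replaced by [N.+1], so that the finite sum has a first term to split
   off. *)
move=> p_gt1 fglF /(_ U_(ord0)%MM)[N /(_ N.+1 (leqnSn N)) <-].
set a := fun i => _; have idZ := zero_is_ideal A.
have a0 : a 0%N = mpsC 1 (t 0%N) * mpsX A ord0 by rewrite /a expn0 expr1.
have va : vanishes_below (@zero_ideal A) 2 (fsum F (a \o S) N - 0).
  rewrite subr0; apply: van_fsum => // i /=.
  apply: vanMl => //; apply: (@van_leq _ _ _ _ (p ^ i.+1)); last exact: van_mpsXn.
  by rewrite (leq_trans p_gt1) // -{1}(expn1 p) leq_pexp2l // ltnW.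
have va0 : vanishes_below (@zero_ideal A) 2 (a 0%N - a 0%N) by rewrite subrr; exact: van0.
have := @van_fadd _ _ idZ F _ _ _ _ _ _ va0 va U_(ord0)%MM.
rewrite mdeg1 => /(_ isT) /eqP.
rewrite -fsumS faddr0 //; last by rewrite a0 mpsCM mpsX_const0 mulr0.
by rewrite mpsBE subr_eq0 => /eqP ->; rewrite a0 mpsCM mpsX_coef eqxx mulr1.
Qed.

(** Write [f1] for the linear coefficient of [f]. Modulo [I] and degree above [q], both
    [f([p]_F1(x)) = [p]_F2(f(x))] and [f(c f1^(q-1) x^q)] are [c f1^q x^q]; since [f1] is
    invertible, [f] can be cancelled. *)
Lemma fgl_hom_pseries_mod (I : A -> Prop) F1 F2 f p q u c :
  is_ideal I -> is_fgl F1 -> is_fgl F2 -> fgl_hom F1 F2 f ->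
  u * f U_(ord0)%MM = 1 -> (0 < q)%N ->
  vanishes_below I q.+1 (nseries F2 p - mpsC 1 c * mpsX A ord0 ^+ q) ->
  vanishes_below I q.+1
    (nseries F1 p - mpsC 1 (c * f U_(ord0)%MM ^+ (q - 1)) * mpsX A ord0 ^+ q).
Proof.
case: q => // q; rewrite subn1 /=.
move=> idI fgl1 fgl2 hf uf _ v2; have [f0 _] := hf.
set f1 := f _ in uf *; set x := mpsX A ord0 in v2 *.
have K0 := tuple1_const0 f0.
have s0 d : (mpsC 1 d * x ^+ q.+1) 0%MM = 0.
  by rewrite mpsCM mpsXn_coef mdeg0 mulr0.
have vs d : vanishes_below I q.+1 (mpsC 1 d * x ^+ q.+1).
  apply: vanMl => //; exact/(van_zero idI)/van_mpsXn.
apply: (mcomp_inj_mod idI _ (s0 _) uf); first exact: nseries_const0.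
rewrite (fgl_hom_nseries _ fgl1 fgl2 hf).
apply: (vanB_trans idI (g := mcomp (mpsC 1 c * x ^+ q.+1) [tuple f])).
  apply: van_mcomp => // i; rewrite subrr; exact: van0.
apply: (vanB_trans idI (g := mpsC 1 c * (mpsC 1 f1 * x) ^+ q.+1)); last first.
  apply: vanB_sym => //.
  have -> : mpsC 1 c * (mpsC 1 f1 * x) ^+ q.+1 =
      mpsC 1 f1 * (mpsC 1 (c * f1 ^+ q) * x ^+ q.+1).
    by rewrite exprMn (rmorphM (mpsC 1)) (rmorphXn (mpsC 1)) /= (exprS (mpsC 1 f1)); ring.
  exact: mcomp_leading0.
(* It remains to replace [f] by [f1 x] in a power of exponent [q.+1]: they agree below degree 2, and
   the power gains [q] more degrees. *)
rewrite mcompM // mcompC // mcompXn // mcompX // -mulrBr; apply: vanMl => //.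
rewrite -[q.+2]addn2.
apply: vanBX_gain => //; first by rewrite mpsCM /x mpsX_const0 mulr0.
apply: van_zero => //; have := van_affine_part f.
by rewrite f0 rmorph0 subr0.
Qed.

End Homomorphisms.

(** * Transformation of the leading coefficient of the p-series *)

Lemma map_comp_inverse (A B : comNzRingType) (j : {rmorphism A -> B})
    (f f' : mps 1 A) :
  comp_inverse f f' -> comp_inverse (map_mps j f) (map_mps j f').
Proof.
case=> f0 f'0 ff' f'f; split.
- by rewrite /map_mps f0 rmorph0.
- by rewrite /map_mps f'0 rmorph0.
- by rewrite -map_mcomp1 ff' map_mpsX.
- by rewrite -map_mcomp1 f'f map_mpsX.
Qed.

(** In the formal sum of the [v_j x^(p^j)], the terms with [j < n] vanish modulo [I], and those with
    [j > n] lie beyond the degree considered. *)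
Lemma pseries_mod (p n : nat) (A : comNzRingType) (I : A -> Prop)
    (G : mps 2 (VZ p)) (phi : {rmorphism VZ p -> A}) :
  (1 < p)%N -> is_ideal I -> is_universal_ptypical G ->
  (forall j, (j < n)%N -> I (phi (vZ p j))) ->
  vanishes_below I (p ^ n).+1
    (nseries (map_mps phi G) p - mpsC 1 (phi (vZ p n)) * mpsX A ord0 ^+ (p ^ n)).
Proof.
move=> p_gt1 idI univG phiI; have [fglG _] := univG.
pose s j := mpsC 1 (phi (vZ p j)) * mpsX A ord0 ^+ (p ^ j).
apply: (vanB_trans idI (g := fsum (map_mps phi G) s n.+1)).
  apply: van_zero => //.
  have := van_map_mps phi (universal_pseries p_gt1 univG (n := n)).
  rewrite rmorphB /= map_nseries map_fsum.
  set s' := fun i => _; suff -> : s' = s by [].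
  by apply/funext => j; rewrite /s' rmorphM rmorphXn /= map_mpsC map_mpsX.
apply: fsum_last => //; first exact: map_fgl.
  by rewrite /s mpsCM mpsXn_coef mdeg0 ltn_eqF ?mulr0 // expn_gt0 (ltn_trans _ p_gt1).
by move=> i /phiI Iv; apply: vanMr => //; exact: vanC.
Qed.

Lemma preim_is_ideal (A B : comNzRingType) (j : {rmorphism A -> B}) (I : B -> Prop) :
  is_ideal I -> is_ideal (fun x => I (j x)).
Proof.
move=> idI; split=> [|x y Ix Iy|a x Ix].
- by rewrite rmorph0; exact: idl0.
- by rewrite rmorphD; exact: idlD.
- by rewrite rmorphM; exact: idlMl.
Qed.

(* Both [p]-series are read at the monomials [x^(p^n)]: below [q = p^N] the one
   of the source vanishes modulo [I], so by induction on [n] the endomorphism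
   sends the coefficients [phi v_n], [n < N], into [I]. *)
Lemma leading_coefficient_transform (p N : nat) (A : comNzRingType)
    (I : A -> Prop) (G : mps 2 (VZ p)) (phi : {rmorphism VZ p -> A})
    (e : {rmorphism A -> A}) (f : mps 1 A) (u : A) :
  (1 < p)%N -> is_ideal I -> is_universal_ptypical G ->
  (forall j, (j < N)%N -> I (phi (vZ p j))) ->
  fgl_hom (map_mps e (map_mps phi G)) (map_mps phi G) f ->
  u * f U_(ord0)%MM = 1 ->
  I (e (phi (vZ p N)) - phi (vZ p N) * f U_(ord0)%MM ^+ (p ^ N - 1)).
Proof.
move=> p_gt1 idI univG vI hf uf; have [fglG _] := univG.
have fglF := map_fgl phi fglG; have fglF' := map_fgl e fglF.
have q_gt0 : (0 < p ^ N)%N by rewrite expn_gt0 (ltn_trans _ p_gt1).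
have := fgl_hom_pseries_mod idI fglF' fglF hf uf q_gt0 (pseries_mod p_gt1 idI univG vI).
rewrite -map_nseries; set P := nseries _ p; set f1 := f _ => vP.
pose m n : 'X_{1..1} := (U_(ord0) *+ (p ^ n))%MM.
have mE n : mdeg (m n) = (p ^ n)%N by rewrite mdegMn mdeg1 mul1n.
(* The factor [*+ (n == N)] treats together the vanishing for [n < N] and the leading term at
   [n = N]. *)
have PI n : (n <= N)%N ->
    I (e (P (m n)) - phi (vZ p N) * f1 ^+ (p ^ N - 1) *+ (n == N)).
  move=> le_nN; have := vP (m n).
  rewrite mE ltnS leq_exp2l // => /(_ le_nN).
  by rewrite mpsBE mpsCM mpsXn_coef mE eqn_exp2l // mulr_natr.
have eI n : (n <= N)%N -> (forall j, (j < n)%N -> I (e (phi (vZ p j)))) ->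
    I (e (phi (vZ p n)) - phi (vZ p N) * f1 ^+ (p ^ N - 1) *+ (n == N)).
  move=> le_nN eIj; apply: (idl_sub_trans idI (y := e (P (m n)))); last exact: PI.
  rewrite -opprB; apply: idlN => //; rewrite -rmorphB.
  (* At this stage [e] is not known to map [I] into itself. The comparison of [phi v_n] with the
     coefficient of the p-series is therefore made modulo the smaller ideal [J], which [e] sends
     into [I] by the assumption on the indices below [n]. *)
  pose J := ideal_span [seq phi (vZ p j) | j <- iota 0 n].
  have idJ : is_ideal J by exact: ideal_span_is_ideal.
  have vJ j : (j < n)%N -> J (phi (vZ p j)).
    by move=> lt_jn; apply: ideal_span_mem; apply: map_f; rewrite mem_iota.
  have JI x : J x -> I (e x).
    apply: (ideal_span_sub (preim_is_ideal e idI)) => y /mapP[j + ->].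
    by rewrite mem_iota => /eIj.
  have mn : (mdeg (m n) < (p ^ n).+1)%N by rewrite mE.
  have := JI _ (pseries_mod p_gt1 idJ univG vJ mn).
  by rewrite mpsBE mpsCM mpsXn_coef mE eqxx mulr1.
have := eI N (leqnn N); rewrite eqxx; apply => n.
elim/ltn_ind: n => n IHn lt_nN.
have := eI n (ltnW lt_nN); rewrite (ltn_eqF lt_nN) subr0; apply=> j lt_jn.
by apply: IHn => //; exact: ltn_trans lt_nN.
Qed.

Theorem theorem4p2 (p h : nat) (hp : prime p) (hh : (2 <= h)%N)
    (k : finFieldType) (hk : #|k| = (p ^ h)%N)
    (W : comNzRingType) (c : W -> nat -> k) (hW : is_witt p c)
    (H : mps 2 k) (hH : is_honda p h H)
    (F : mps 2 (LT h W)) (hF : is_lubin_tate_fgl p F)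
    (g : mps 1 k) (hg : stabilizer H g)
    (gstar : {rmorphism LT h W -> LT h W}) (t : nat -> LT h W)
    (ht : is_action p c F g gstar t) :
  LTI p h W h.-1
    (gstar (LTu h W h.-1) - LTu h W h.-1 * t 0%N ^+ (p ^ h.-1 - 1)).
Proof.
have p_gt1 := prime_gt1 hp.
case: ht => ghat [ghat' [f [[invg _] _ _ [[hf [f' invf]] _] fsum_t]]].
case: hF => G [phi [univG phi_u _ _ FE]]; have [fglG _] := univG.
have fglF : is_fgl F by rewrite FE; exact: map_fgl.
pose j : {rmorphism W -> LT h W} := mpsC h.-1.
have invl := map_comp_inverse j invg.
have hhom := fgl_hom_twist (map_fgl gstar fglF) fglF invl hf.
have t0E := infinite_fsum_leading p_gt1 fglF fsum_t.
(* The linear coefficient of [h_g] is the product of those of the lift and of [f]; its inverse comes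
   from their compositional inverses. *)
have ut : map_mps j ghat' U_(ord0)%MM * f' U_(ord0)%MM * t 0%N = 1.
  have [f0 _ _ _] := invf; have [l0 _ _ _] := invl.
  have lt12 : (@mdeg 1 U_(ord0)%MM < 2)%N by rewrite mdeg1.
  have /van1P f1 := f0.
  have := mcomp_leading0 (zero_is_ideal _) l0 f0 f1 lt12.
  rewrite mpsBE mpsCM t0E => /eqP; rewrite subr_eq0 => /eqP ->.
  have lu := comp_inverse_leading invl; have fu := comp_inverse_leading invf.
  by rewrite mulrACA (mulrC (f' _)) fu mulr1 mulrC lu.
have phi_uN : phi (vZ p h.-1) = LTu h W h.-1.
  by apply: phi_u; case: (h) hh => [|[|n]] //= _; rewrite ltnSn.
have idI : is_ideal (LTI p h W h.-1) by exact: ideal_span_is_ideal.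
rewrite -phi_uN -t0E; rewrite -t0E in ut; rewrite FE in hhom.
(* The images of [v_0 = p] and of the [v_i] with [0 < i < h - 1] are exactly the generators of the
   ideal. *)
apply: (leading_coefficient_transform p_gt1 idI univG _ hhom ut) => -[|i] lt_i.
  by rewrite rmorph_nat; apply: ideal_span_mem; rewrite mem_head.
have lt_ih : (0 < i.+1 < h)%N by rewrite (leq_trans lt_i) // leq_pred.
rewrite phi_u //; apply: ideal_span_mem; rewrite inE; apply/orP; right.
by apply: map_f; rewrite mem_iota /= add1n prednK // (leq_ltn_trans _ lt_i).
Qed.
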